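(* $\mathbf{VC}$ holds for any differential operator $\Lambda\in\mathbb{D}_1$; that is, for every $n\ge1$, every $\Lambda=\sum_{i=1}^n\beta_iD_i$ with $\beta_i\in\mathbb{C}$, and every $\Lambda$-nilpotent polynomial $P\in\mathbb{C}[z_1,\dots,z_n]$, one has $\Lambda^m(P^{m+1})=0$ for all sufficiently large $m$.
   Context: $D_i=\partial/\partial z_i$. $\mathbb{D}_1$ is the set of homogeneous first order differential operators with constant complex coefficients (in any finite number of variables). A polynomial $P$ is $\Lambda$-nilpotent if $\Lambda^m(P^m)=0$ for all $m\ge1$. *)

(* Defs.v *)
From mathcomp Require Import all_boot all_algebra.
From mathcomp Require Import reals complex mpoly.

Set Implicit Arguments.
Unset Strict Implicit.
Unset Printing Implicit Defensive.

Import GRing.Theory.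
Local Open Scope ring_scope.

(* With [R : realType], a complete ordered field, [R[i]] is the field of
   complex numbers. *)

Definition diffop1 (R : realType) (n : nat) (beta : 'I_n -> R[i])
    (p : {mpoly R[i][n]}) : {mpoly R[i][n]} :=
  \sum_(i < n) beta i *: mderiv i p.

Definition in_D1 (R : realType) (n : nat)
    (L : {mpoly R[i][n]} -> {mpoly R[i][n]}) : Prop :=
  exists beta : 'I_n -> R[i], L =1 diffop1 beta.

Definition op_nilpotent (R : realType) (n : nat)
    (L : {mpoly R[i][n]} -> {mpoly R[i][n]}) (P : {mpoly R[i][n]}) : Prop :=
  forall m : nat, (1 <= m)%N -> iter m L (P ^+ m) = 0.

(* The vanishing conjecture VC for the operator [L]. *)
Definition vanishing (R : realType) (n : nat)
    (L : {mpoly R[i][n]} -> {mpoly R[i][n]}) : Prop :=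
  forall P : {mpoly R[i][n]}, op_nilpotent L P ->
  exists N : nat, forall m : nat, (N <= m)%N -> iter m L (P ^+ m.+1) = 0.

(* Main.v *)
(* The case [m = 1] of nilpotency already says [L P = 0]; as [L] is a
   derivation, it kills every power of [P]. *)
Require Import Defs.
From mathcomp Require Import all_boot all_algebra.
From mathcomp Require Import reals complex mpoly.

Local Open Scope ring_scope.
Import GRing.Theory.

(** By the Leibniz rule [diffop1M], the kernel of a first-order operator is closed under powers
    ([diffop1X_eq0]). Nilpotency puts [P] in this kernel, so a single application already kills
    [P ^+ m.+1]. *)

Lemma diffop1_0 (R : realType) (n : nat) (beta : 'I_n -> R[i]) :
  diffop1 beta 0 = 0.
Proof. by apply: big1 => i _; rewrite mderiv0 scaler0. Qed.

Lemma diffop1_1 (R : realType) (n : nat) (beta : 'I_n -> R[i]) :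
  diffop1 beta 1 = 0.
Proof. by apply: big1 => i _; rewrite -mpolyC1 mderivC scaler0. Qed.

Lemma diffop1M (R : realType) (n : nat) (beta : 'I_n -> R[i])
    (p q : {mpoly R[i][n]}) :
  diffop1 beta (p * q) = diffop1 beta p * q + p * diffop1 beta q.
Proof.
rewrite /diffop1 mulr_suml mulr_sumr -big_split; apply: eq_bigr => i _ /=.
by rewrite mderivM scalerDr scalerAl scalerAr.
Qed.

Lemma diffop1X_eq0 (R : realType) (n : nat) (beta : 'I_n -> R[i])
    (p : {mpoly R[i][n]}) (k : nat) :
  diffop1 beta p = 0 -> diffop1 beta (p ^+ k) = 0.
Proof.
move=> Dp0; elim: k => [|k IHk]; first by rewrite expr0 diffop1_1.
by rewrite exprS diffop1M Dp0 IHk mul0r mulr0 addr0.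
Qed.

Theorem corollary3p19 (R : realType) (n : nat) (hn : (1 <= n)%N)
    (L : {mpoly R[i][n]} -> {mpoly R[i][n]}) (hL : in_D1 L) :
  vanishing L.
Proof.
(* The bound is 1 because for [m = 0] no operator is applied and [P] itself remains. *)
case: hL => beta LE P nilP; exists 1%N => -[//|m] _.
have DP0 : diffop1 beta P = 0 by rewrite -LE; exact: (nilP 1%N).
(* The innermost application gives 0; the others preserve it. *)
rewrite iterSr LE diffop1X_eq0 //.
by elim: m => [//|m IHm]; rewrite iterS IHm LE diffop1_0.
Qed.
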